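(* Suppose that $0<H\le \frac12$. Assume that $\zeta=(\zeta(t))_{t\ge 0}$ is a centered Gaussian process with covariance function $$Q_{2H}(s,t)=(\max(s,t))^{2H}-|t-s|^{2H},\qquad s,t\ge 0,$$ and that $\beta=(\beta(t))_{t\ge 0}$ is a standard Brownian motion independent of $\zeta$. Then the process $$\frac{1}{\sqrt 2}\left(\zeta(t)+\beta(t^{2H})\right),\qquad t\ge 0,$$ is a fractional Brownian motion with Hurst parameter $H$, i.e. a centered Gaussian process with covariance function $$S_H(s,t)=\frac12\left(s^{2H}+t^{2H}-|t-s|^{2H}\right),\qquad s,t\ge 0.$$
   Context: Fractional Brownian motion with Hurst parameter $H$ means a centered Gaussian process indexed by $[0,\infty)$ with covariance function $S_H$ as given in the claim (no path regularity is part of the definition). *)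

(* Defs.v *)
From HB Require Import structures.
From mathcomp Require Import all_boot all_order all_algebra.
From mathcomp Require Import all_classical all_reals all_analysis.

Set Implicit Arguments.
Unset Strict Implicit.
Unset Printing Implicit Defensive.

Import Order.TTheory GRing.Theory Num.Theory.
Import numFieldNormedType.Exports.

Local Open Scope classical_set_scope.
Local Open Scope ring_scope.

Section gaussian.
Context {R : realType}.

(* [normal_prob m 0] is a placeholder (uniform on `[0, 1]), hence the explicit
   degenerate case. *)
Definition gaussian_law (m s : R) : set (measurableTypeR R) -> \bar R :=
  if s == 0 then \d_m else normal_prob m s.

Context {d : measure_display} {T : measurableType d} (P : probability T R).

(* A measure is a total function on sets, unconstrained on the non-measurable
   ones: laws are therefore compared on measurable sets only. *)
Definition gaussian_rv (X : T -> R) : Prop :=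
  measurable_fun setT X /\
  exists m s : R, forall A : set R, measurable A ->
    pushforward P X A = gaussian_law m s A.

Definition gaussian_process (I : Type) (X : I -> T -> R) : Prop :=
  forall (n : nat) (t : 'I_n -> I) (c : 'I_n -> R),
    gaussian_rv (fun w => \sum_(i < n) c i * X (t i) w).

Definition centered_gaussian_process (I : Type) (X : I -> T -> R)
    (K : I -> I -> R) : Prop :=
  [/\ gaussian_process X,
      forall t, ('E_P[X t] = 0)%E &
      forall s t, covariance P (X s) (X t) = (K s t)%:E].

Definition process_sigma_algebra (I : Type) (X : I -> T -> R) :
    set (set T) :=
  <<s \bigcup_t preimage_set_system setT (X t) measurable >>.

Definition independent_processes (I J : Type) (X : I -> T -> R)
    (Y : J -> T -> R) : Prop :=
  forall A B : set T, process_sigma_algebra X A -> process_sigma_algebra Y B ->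
    P (A `&` B) = (P A * P B)%E.

(* Path continuity is not required, as for fractional Brownian motion below (of
   which this is the case H = 1/2). *)
Definition standard_brownian_motion (B : {nonneg R} -> T -> R) : Prop :=
  centered_gaussian_process B (fun s t => Num.min s%:num t%:num).

Definition fbm_cov (H : R) (s t : {nonneg R}) : R :=
  2^-1 * (s%:num `^ (2 * H) + t%:num `^ (2 * H)
          - `|t%:num - s%:num| `^ (2 * H)).

Definition fractional_brownian_motion (H : R)
    (X : {nonneg R} -> T -> R) : Prop :=
  centered_gaussian_process X (fbm_cov H).

Definition Q_cov (a : R) (s t : {nonneg R}) : R :=
  (Num.max s%:num t%:num) `^ a - `|t%:num - s%:num| `^ a.

End gaussian.

(* Main.v *)
Require Import Defs.
From HB Require Import structures.
From mathcomp Require Import all_boot all_order all_algebra.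
From mathcomp Require Import all_classical all_reals all_analysis.
From mathcomp Require Import measurable_realfun ring.

(** The covariance is the algebraic part. Since [x `^ (2 * H)] is increasing,
    [max s t `^ (2 * H) + min (s `^ (2 * H)) (t `^ (2 * H))] is
    [s `^ (2 * H) + t `^ (2 * H)], so the covariance of [zeta] plus that of
    the time-changed Brownian motion is twice the covariance of fractional
    Brownian motion ([Q_cov_add_min]); the factor [1 / sqrt 2] absorbs the 2.

    The probabilistic part holds for any two independent centered Gaussian
    processes ([add_independent_gaussian_process]). Covariances add up because
    independent square-integrable variables are uncorrelated, and
    square-integrability is itself read off the finite variances in the
    hypotheses. A linear combination of the sum splits into a linear
    combination of each process; these are independent, being measurable for
    independent sigma-algebras, and each is Gaussian. So everything rests on the
    stability of Gaussian laws under sums of independent variables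
    ([gaussian_rv_add]).

    For that, independence identifies the joint law of [(U, V)] with the product
    of the two laws ([joint_law]), so that the law of [U + V] is a convolution
    ([law_of_sum]). A Dirac factor only translates the other law. For two
    normal laws, Tonelli's theorem reduces the convolution to the integral of
    [normal_pdf (m2 + x) s2 z * normal_pdf m1 s1 x] over [x]; completing the
    square in [x] turns this product into the target density at [z] times a
    normal density in [x] ([normal_pdf_mul]), whose integral is 1. No Gaussian
    integral has to be computed, and translation invariance of the Lebesgue
    measure supplies the shifts. *)

Set Implicit Arguments.
Unset Strict Implicit.
Unset Printing Implicit Defensive.

Import Order.TTheory GRing.Theory Num.Theory.
Import numFieldNormedType.Exports.

Local Open Scope classical_set_scope.
Local Open Scope ring_scope.

(** * Translations of the real line *)

Section translation.
Context {R : realType}.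
Local Notation mu := (@lebesgue_measure R).

Lemma measurable_shift_preimage (a : R) (A : set R) : measurable A ->
  measurable ((fun x => x + a) @^-1` A).
Proof.
have mf : measurable_fun setT (fun x : R => x + a) by exact: measurable_funD.
by move=> mA; rewrite -[X in measurable X]setTI; exact: mf.
Qed.

(** A measure on the Borel sets is the Lebesgue measure as soon as it agrees
    with it on half-open intervals, and translating an interval preserves its
    length. *)
Lemma lebesgue_measure_shift (a : R) (A : set R) : measurable A ->
  mu ((fun x => x + a) @^-1` A) = mu A.
Proof.
pose f : measurableTypeR R -> measurableTypeR R := fun x => x + a.
have mf : measurable_fun setT f by exact: measurable_funD.
pose F : {mfun measurableTypeR R >-> measurableTypeR R} :=
  HB.pack f (isMeasurableFun.Build _ _ _ _ f mf).
move=> mA; apply/esym.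
apply: (lebesgue_measure_unique (mu := pushforward mu F)) => // X [[x y] _ <-].
have FE : F @^-1` `]x, y]%classic = `]x - a, y - a]%classic.
  by apply/seteqP; split=> z /=; rewrite !in_itv/= /f ltrBlDr lerBrDr.
transitivity (mu `]x - a, y - a]%classic); last by rewrite -FE.
rewrite !lebesgue_measure_itv/= !lte_fin ltrD2r.
by rewrite -!EFinD opprB addrA subrK.
Qed.

Lemma ge0_integral_shift (a : R) (A : set R) (f : R -> \bar R) :
  measurable A -> measurable_fun A f -> (forall x, 0 <= f x)%E ->
  (\int[mu]_(x in (fun x => (x + a)%R) @^-1` A) f (x + a)%R =
   \int[mu]_(x in A) f x)%E.
Proof.
move=> mA mf f0.
have mT : measurable_fun setT
    ((fun x : R => x + a) : measurableTypeR R -> measurableTypeR R).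
  exact: measurable_funD.
rewrite -(ge0_integral_pushforward mT mu mA mf) //.
apply: eq_measure_integral => B mB _; exact: lebesgue_measure_shift.
Qed.

End translation.

(** * Convolution of normal laws *)

(** With [p] and [q] the variances, this is the exponent of a product of two
    normal densities: the second term on the right, the only one to contain
    [u], is again a square centered at a multiple of [v]. *)
Lemma complete_square (F : fieldType) (p q u v : F) :
  p != 0 -> q != 0 -> p + q != 0 ->
  (v - u) ^+ 2 / q + u ^+ 2 / p =
  v ^+ 2 / (p + q) + (u - p * v / (p + q)) ^+ 2 / (p * q / (p + q)).
Proof. by move=> p0 q0 pq0; field; rewrite pq0 p0 q0. Qed.

Section normal.
Context {R : realType}.
Implicit Types m s x z : R.

Lemma normal_pdf_shift m s x z : s != 0 ->
  normal_pdf m s z = normal_pdf (m + x) s (z + x).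
Proof.
move=> s0; rewrite !normal_pdfE// /normal_fun.
by rewrite opprD addrACA subrr addr0.
Qed.

Lemma normal_prob_shift m s x (A : set R) : s != 0 -> measurable A ->
  normal_prob m s ((fun z => z + x) @^-1` A) = normal_prob (m + x) s A.
Proof.
move=> s0 mA; rewrite /normal_prob.
under eq_integral do rewrite (normal_pdf_shift m x)//.
apply: (ge0_integral_shift x (f := fun z => (normal_pdf (m + x) s z)%:E)) => //.
- by apply: measurable_funTS; apply/measurable_EFinP; exact: measurable_normal_pdf.
- by move=> z; rewrite lee_fin normal_pdf_ge0.
Qed.

(** The Radon-Nikodym derivative of a normal law is defined only up to a null
    set; it agrees almost everywhere with the density because both have the same
    integral over every measurable set. *)
Lemma integral_normal_prob m s (f : R -> \bar R) :
  (normal_prob m s).-integrable setT f ->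
  (\int[normal_prob m s]_x f x =
   \int[lebesgue_measure]_x (f x * (normal_pdf m s x)%:E))%E.
Proof.
move=> intf; have mf := measurable_int _ intf.
rewrite -(Radon_Nikodym_change_of_variables (normal_prob_dominates m s))//=.
apply: ae_eq_integral => //.
- apply: emeasurable_funM => //; apply: (measurable_int lebesgue_measure).
  by apply: Radon_Nikodym_integrable; exact: normal_prob_dominates.
- apply: emeasurable_funM => //.
  by apply/measurable_EFinP; exact: measurable_normal_pdf.
- apply: ae_eqe_mul2l => /=.
  apply: integral_ae_eq => //=.
  + apply: Radon_Nikodym_integrable; exact: normal_prob_dominates.
  + by apply/measurable_EFinP; exact: measurable_normal_pdf.
  + move=> E _ mE; rewrite -Radon_Nikodym_integral//=.
    exact: normal_prob_dominates.
Qed.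

(** The joint density of [x] and of [z], the sum of [x] and an independent
    normal variable, factored as the density of the sum times the conditional
    density of [x] given [z]. *)
Lemma normal_pdf_mul m1 s1 m2 s2 x z : s1 != 0 -> s2 != 0 ->
  let s := Num.sqrt (s1 ^+ 2 + s2 ^+ 2) in
  normal_pdf (m2 + x) s2 z * normal_pdf m1 s1 x =
  normal_pdf (m1 + m2) s z *
  normal_pdf ((m1 * s2 ^+ 2 + (z - m2) * s1 ^+ 2) / s ^+ 2) (s1 * s2 / s) x.
Proof.
move=> s10 s20 s.
have s2E : s ^+ 2 = s1 ^+ 2 + s2 ^+ 2.
  by rewrite sqr_sqrtr// addr_ge0 ?sqr_ge0.
have q10 : s1 ^+ 2 != 0 by rewrite sqrf_eq0.
have q20 : s2 ^+ 2 != 0 by rewrite sqrf_eq0.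
have ss0 : s1 ^+ 2 + s2 ^+ 2 != 0.
  by rewrite gt_eqF// ltr_pwDl ?sqr_ge0// lt_neqAle eq_sym q10 sqr_ge0.
have s0 : s != 0 by rewrite -sqrf_eq0 s2E.
have t0 : s1 * s2 / s != 0 by rewrite !mulf_neq0// invr_eq0.
rewrite !normal_pdfE//= mulrACA [RHS]mulrACA; congr (_ * _).
  have peak_ge0 u : 0 <= u ^+ 2 * pi *+ 2 :> R.
    by rewrite mulrn_wge0// mulr_ge0 ?sqr_ge0// pi_ge0.
  rewrite /normal_peak -!invfM -!sqrtrM ?peak_ge0//.
  congr (Num.sqrt _)^-1; rewrite -!mulrnAr exprMn exprVn s2E exprMn.
  by move: (pi *+ 2) => c; field.
rewrite /normal_fun/= -!expRD; congr expR.
(* The factor 1/2 is kept abstract: [2] is itself of the form [1 *+ 2], so an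
   explicit [2^-1] would be rewritten again and again. *)
have [k halve] : exists k, forall a b : R, a / (b *+ 2) = a / b * k.
  by exists 2^-1 => a b; rewrite -(mulr_natr b) invfM mulrA.
rewrite exprMn exprVn s2E exprMn !halve -!mulrDl.
congr (_ * k); rewrite !mulNr -!opprD; congr (- _).
have -> : z - (m2 + x) = (z - (m1 + m2)) - (x - m1) by ring.
have -> : x - (m1 * s2 ^+ 2 + (z - m2) * s1 ^+ 2) / (s1 ^+ 2 + s2 ^+ 2) =
    (x - m1) - s1 ^+ 2 * (z - (m1 + m2)) / (s1 ^+ 2 + s2 ^+ 2) by field.
exact: complete_square.
Qed.

(** The left-hand side is the law of a sum of independent normal variables:
    given the value [x] of the first, the sum is normal with mean [m2 + x]. *)
Lemma normal_prob_conv m1 s1 m2 s2 (A : set R) : s1 != 0 -> s2 != 0 ->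
  measurable A ->
  (\int[normal_prob m1 s1]_x normal_prob (m2 + x)%R s2 A =
   normal_prob (m1 + m2)%R (Num.sqrt (s1 ^+ 2 + s2 ^+ 2)) A)%E.
Proof.
move=> s10 s20 mA.
set s := Num.sqrt _.
pose g (p : R * R) := (normal_pdf (m2 + p.1) s2 p.2)%:E.
have gE x z : g (x, z) = (normal_pdf m2 s2 (z - x))%:E.
  by rewrite /g/= (normal_pdf_shift m2 x)// subrK.
have mg : measurable_fun setT g.
  apply: (eq_measurable_fun (fun p : R * R => (normal_pdf m2 s2 (p.2 - p.1))%:E)).
    by move=> [x z] _; rewrite gE.
  apply/measurable_EFinP; apply: measurableT_comp; first exact: measurable_normal_pdf.
  exact: measurable_funB.
(* The domain [A] is moved into the integrand as an indicator, so that Tonelli's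
   theorem applies on the whole plane. *)
have mgA : measurable_fun setT (fun p : R * R => g p * (\1_A p.2)%:E)%E.
  apply: emeasurable_funM => //; apply/measurable_EFinP.
  apply: measurableT_comp => //.
have g0 p : (0 <= g p)%E by rewrite lee_fin normal_pdf_ge0.
have NE x : normal_prob (m2 + x) s2 A =
   (\int[lebesgue_measure]_z (g (x, z) * (\1_A z)%:E))%E.
  by rewrite /normal_prob integral_mkcond epatch_indic.
have mN : measurable_fun setT (fun x => normal_prob (m2 + x) s2 A).
  rewrite (_ : (fun _ => _) = fubini_F lebesgue_measure
      (fun p : R * R => g p * (\1_A p.2)%:E)%E); last first.
    by apply/funext => x; rewrite NE.
  apply: measurable_fun_fubini_tonelli_F => //.
  by move=> p; rewrite mule_ge0// lee_fin.
rewrite integral_normal_prob; last first.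
  apply/integrableP; split => //.
  apply: (@le_lt_trans _ _ (\int[normal_prob m1 s1]_x cst 1 x)%E).
    apply: ge0_le_integral => //=; first exact: measurableT_comp.
    by move=> x _; rewrite gee0_abs// probability_le1.
  by rewrite integral_cst//= mul1e probability_setT ltry.
pose h (p : R * R) := (g p * (\1_A p.2)%:E * (normal_pdf m1 s1 p.1)%:E)%E.
transitivity (\int[lebesgue_measure]_x \int[lebesgue_measure]_z h (x, z))%E.
  apply: eq_integral => x _; rewrite NE /h/= -ge0_integralZr//.
  - apply: (measurableT_comp mgA); exact: measurable_pair1.
  - by move=> z _; rewrite mule_ge0// lee_fin.
  - by rewrite lee_fin normal_pdf_ge0.
rewrite (fubini_tonelli (m1 := lebesgue_measure) (m2 := lebesgue_measure)); last 2 first.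
- apply: emeasurable_funM => //; apply/measurable_EFinP.
  apply: measurableT_comp => //; exact: measurable_normal_pdf.
- by move=> p; rewrite !mule_ge0// lee_fin// normal_pdf_ge0.
rewrite /normal_prob [RHS]integral_mkcond epatch_indic; apply: eq_integral => z _.
transitivity (\int[lebesgue_measure]_x ((normal_pdf (m1 + m2) s z * \1_A z)%:E *
  (normal_pdf ((m1 * s2 ^+ 2 + (z - m2) * s1 ^+ 2) / s ^+ 2) (s1 * s2 / s) x)%:E))%E.
  apply: eq_integral => x _.
  by rewrite /h /g/= -!EFinM mulrAC normal_pdf_mul// mulrAC.
rewrite ge0_integralZl//.
- by rewrite integral_normal_pdf mule1 EFinM.
- by apply/measurable_EFinP; exact: measurable_normal_pdf.
- by move=> x _; rewrite lee_fin normal_pdf_ge0.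
- by rewrite lee_fin mulr_ge0// normal_pdf_ge0.
Qed.

End normal.

(** * Independent random variables *)

Section independence.
Context {R : realType} {d : measure_display} {T : measurableType d}.
Context (P : probability T R).
Local Notation borel := (measurableTypeR R).

Definition independent_rv (U V : T -> R) : Prop :=
  forall A B : set R, measurable A -> measurable B ->
    P (U @^-1` A `&` V @^-1` B) = (P (U @^-1` A) * P (V @^-1` B))%E.

Lemma independent_rv_sym (U V : T -> R) :
  independent_rv U V -> independent_rv V U.
Proof. by move=> UV A B mA mB; rewrite setIC UV// muleC. Qed.

(** The Lebesgue measure lives on [measurableTypeR R], whose measurable sets are
    those of [R] but which is another structure; laws are taken there, so that
    they can be integrated together with normal laws. *)
Definition borel_rv (U : T -> R) (mU : measurable_fun setT U) :
    {RV P >-> borel} :=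
  HB.pack (U : T -> borel) (isMeasurableFun.Build _ _ T borel U mU).

Lemma measurable_joint (U V : {RV P >-> borel}) :
  measurable_fun setT (fun w => (U w, V w) : borel * borel).
Proof. exact: measurable_fun_pair. Qed.

Definition joint_rv (U V : {RV P >-> borel}) :
    {mfun T >-> (borel * borel)%type} :=
  HB.pack (fun w => (U w, V w) : borel * borel)
    (isMeasurableFun.Build _ _ T (borel * borel)%type _ (measurable_joint U V)).

(** Independence is exactly the defining property of the product measure on
    rectangles, and rectangles determine it. *)
Lemma joint_law (U V : {RV P >-> borel}) (X : set (borel * borel)) :
  independent_rv U V -> measurable X ->
  distribution P (joint_rv U V) X =
  (distribution P U \x distribution P V)%E X.
Proof. by move=> UV mX; apply/esym; exact: product_measure_unique. Qed.

Lemma law_of_sum (U V : {RV P >-> borel}) (A : set R) :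
  independent_rv U V -> measurable A ->
  pushforward P (U \+ V) A =
  (\int[distribution P U]_x
     distribution P V ((fun y => (y + x)%R) @^-1` A))%E.
Proof.
move=> UV mA.
have mS : measurable ((fun p : R * R => p.1 + p.2) @^-1` A).
  rewrite -[X in measurable X]setTI.
  have mf : measurable_fun setT (fun p : R * R => p.1 + p.2).
    exact: measurable_funD.
  exact: mf.
transitivity (distribution P (joint_rv U V)
    ((fun p : R * R => p.1 + p.2) @^-1` A)); first by [].
rewrite joint_law//; apply: eq_integral => x _ /=; congr (P (_ @^-1` _)).
by apply/seteqP; split => y; rewrite /xsection/= inE/= addrC.
Qed.

(** Fubini's theorem on the product law; square-integrability makes the product
    [U * V] integrable. *)
Lemma expectation_mul_independent (U V : T -> R) :
  independent_rv U V -> U \in Lfun P 2%:E -> V \in Lfun P 2%:E ->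
  ('E_P[U * V] = 'E_P[U] * 'E_P[V])%E.
Proof.
move=> UV U2 V2.
have Pfin : P setT \is a fin_num by exact: fin_num_measure.
have U1 := Lfun_subset12 Pfin U2.
have V1 := Lfun_subset12 Pfin V2.
have UV1 := Lfun2_mul_Lfun1 U2 V2.
have mU : measurable_fun setT U by move: U2; rewrite inE => /andP[/[!inE]].
have mV : measurable_fun setT V by move: V2; rewrite inE => /andP[/[!inE]].
pose U' := borel_rv mU.
pose V' := borel_rv mV.
have iU := (Lfun1_integrable _ _).1 U1.
have iV := (Lfun1_integrable _ _).1 V1.
have iUV := (Lfun1_integrable _ _).1 UV1.
pose f (p : borel * borel) := (p.1 * p.2)%:E.
have mf : measurable_fun setT f.
  by apply/measurable_EFinP; exact: measurable_funM.
have jointE (X : set (borel * borel)) : measurable X -> X `<=` setT ->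
    distribution P (joint_rv U' V') X =
    (distribution P U' \x distribution P V')%E X.
  by move=> mX _; exact: joint_law.
have intf : (distribution P U' \x distribution P V')%E.-integrable setT f.
  have /integrableP[_ fin] :=
    integrable_pushforward (measurable_joint U' V') (mu := P) (D := setT)
      mf iUV measurableT.
  apply/integrableP; split => //.
  by rewrite -(eq_measure_integral _ jointE).
transitivity (\int[distribution P U' \x distribution P V']_p f p)%E.
  rewrite unlock -(eq_measure_integral _ jointE).
  by rewrite (integral_pushforward (measurable_joint U' V') (mu := P)
    (D := setT) mf iUV).
rewrite -integral12_prod_meas1//.
have -> : ('E_P[U] = \int[distribution P U']_x x%:E)%E.
  by rewrite integral_distribution// unlock.
have EV : ('E_P[V] = \int[distribution P V']_x x%:E)%E.
  by rewrite integral_distribution// unlock.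
have EVfin := expectation_fin_num V1.
have iU' : (distribution P U').-integrable setT (fun x => x%:E).
  by apply: integrable_pushforward => //; exact: EFin_measurable.
have iV' : (distribution P V').-integrable setT (fun x => x%:E).
  by apply: integrable_pushforward => //; exact: EFin_measurable.
rewrite -(fineK EVfin) -integralZr//; apply: eq_integral => x _.
by rewrite /fubini_F/f fineK// EV -integralZl.
Qed.

Lemma independent_covariance0 (U V : T -> R) :
  independent_rv U V -> U \in Lfun P 2%:E -> V \in Lfun P 2%:E ->
  covariance P U V = 0%E.
Proof.
move=> UV U2 V2.
have Pfin : P setT \is a fin_num by exact: fin_num_measure.
have U1 := Lfun_subset12 Pfin U2.
have V1 := Lfun_subset12 Pfin V2.
rewrite covarianceE//; last exact: Lfun2_mul_Lfun1.
rewrite expectation_mul_independent// subee//.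
by rewrite fin_numM// expectation_fin_num.
Qed.

End independence.

(** * Sums of independent Gaussian variables *)

Section gaussian_sum.
Context {R : realType}.

Lemma gaussian_law_shift (m s x : R) (A : set R) : measurable A ->
  gaussian_law m s ((fun z => z + x) @^-1` A) = gaussian_law (m + x) s A.
Proof.
move=> mA; rewrite /gaussian_law; case: eqVneq => [_|s0].
  by rewrite !diracE; congr (_%:R%:E); congr nat_of_bool; rewrite !inE.
exact: normal_prob_shift.
Qed.

Context {d : measure_display} {T : measurableType d} (P : probability T R).

(** The degenerate case of [gaussian_rv_add], where the convolution with a point
    mass is a translation. It is separate because [gaussian_law] is then not
    given by a density. *)
Lemma gaussian_rv_add_dirac (U V : T -> R) (m : R) :
  independent_rv P U V -> gaussian_rv P U -> measurable_fun setT V ->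
  (forall A : set R, measurable A -> pushforward P V A = \d_m A) ->
  gaussian_rv P (U \+ V).
Proof.
move=> UV [mU [m1 [s1 lawU]]] mV lawV.
pose U' := borel_rv P mU.
pose V' := borel_rv P mV.
split; first exact: measurable_funD.
exists (m1 + m), s1 => A mA.
have mshift x := measurable_shift_preimage x mA.
rewrite (law_of_sum (U := U') (V := V') UV mA) -gaussian_law_shift// -lawU//.
transitivity (\int[distribution P U']_x
    (\1_((fun z : R => (z + m)%R) @^-1` A) x)%:E)%E; last first.
  rewrite integral_indic; [exact: (congr1 (pushforward P U) (setIT _))|by []|].
  exact: mshift.
apply: eq_integral => x _.
transitivity (\d_m ((fun y => y + x) @^-1` A) : \bar R); first exact: lawV.
rewrite diracE indicE; congr (_%:R%:E); congr nat_of_bool.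
by apply/idP/idP; rewrite !inE/= addrC.
Qed.

Lemma gaussian_rv_add (U V : T -> R) :
  independent_rv P U V -> gaussian_rv P U -> gaussian_rv P V ->
  gaussian_rv P (U \+ V).
Proof.
move=> UV gU gV; have [mU [m1 [s1 lawU]]] := gU.
have [mV [m2 [s2 lawV]]] := gV.
have [s20|s20] := eqVneq s2 0.
  apply: (gaussian_rv_add_dirac (m := m2)) => // A mA.
  by rewrite lawV// /gaussian_law s20 eqxx.
have [s10|s10] := eqVneq s1 0.
  (* Independence is symmetric, so the same lemma covers a degenerate [U]. *)
  have -> : U \+ V = V \+ U by apply/funext => w /=; rewrite addrC.
  apply: (gaussian_rv_add_dirac (m := m1)) => //.
    exact: independent_rv_sym.
  by move=> A mA; rewrite lawU// /gaussian_law s10 eqxx.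
split; first exact: measurable_funD.
exists (m1 + m2), (Num.sqrt (s1 ^+ 2 + s2 ^+ 2)) => A mA.
pose U' := borel_rv P mU.
pose V' := borel_rv P mV.
have s0 : Num.sqrt (s1 ^+ 2 + s2 ^+ 2) != 0.
  rewrite sqrtr_eq0 -ltNge ltr_pwDl ?sqr_ge0//.
  by rewrite exprn_even_gt0.
rewrite /gaussian_law (negbTE s0) -normal_prob_conv//.
rewrite (law_of_sum (U := U') (V := V') UV mA).
transitivity (\int[distribution P U']_x normal_prob (m2 + x)%R s2 A)%E;
    last first.
  apply: eq_measure_integral => B mB _.
  transitivity (gaussian_law m1 s1 B); first exact: lawU.
  by rewrite /gaussian_law (negbTE s10).
apply: eq_integral => x _.
have mshift := measurable_shift_preimage x mA.
rewrite -normal_prob_shift//.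
by rewrite -[LHS]/(pushforward P V _) lawV// /gaussian_law (negbTE s20).
Qed.

End gaussian_sum.

(** * Gaussian processes *)

Section processes.
Context {R : realType} {d : measure_display} {T : measurableType d}.
Context (P : probability T R).

(** Each coordinate is measurable for the sigma-algebra it helps to generate,
    hence so are their linear combinations; the sigma-algebra is made the
    structure of the domain to reuse the closure properties of measurable
    functions. *)
Lemma linear_combination_process_sigma_algebra (I : Type) (X : I -> T -> R)
    (n : nat) (t : 'I_n -> I) (c : 'I_n -> R) (A : set R) :
  measurable A ->
  process_sigma_algebra X ((fun w => \sum_(i < n) c i * X (t i) w) @^-1` A).
Proof.
move=> mA.
pose G := \bigcup_t preimage_set_system setT (X t) measurable.
have mX i : measurable_fun (setT : set (g_sigma_algebraType G)) (X i).
  by move=> _ B mB; apply: sub_sigma_algebra; exists i => //; exists B.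
have mS : measurable_fun (setT : set (g_sigma_algebraType G))
    (fun w => \sum_(i < n) c i * X (t i) w).
  by apply: measurable_sum => i; apply: measurable_funM => //; exact: mX.
by have := mS measurableT A mA; rewrite setTI.
Qed.

Lemma independent_linear_combinations (I J : Type)
    (X : I -> T -> R) (Y : J -> T -> R) (n p : nat)
    (t : 'I_n -> I) (a : 'I_n -> R) (u : 'I_p -> J) (b : 'I_p -> R) :
  independent_processes P X Y ->
  independent_rv P (fun w => \sum_(i < n) a i * X (t i) w)
                   (fun w => \sum_(i < p) b i * Y (u i) w).
Proof.
by move=> XY A B mA mB; apply: XY;
  exact: linear_combination_process_sigma_algebra.
Qed.

Lemma independent_coordinates (I J : Type)
    (X : I -> T -> R) (Y : J -> T -> R) (i : I) (j : J) :
  independent_processes P X Y -> independent_rv P (X i) (Y j).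
Proof.
move=> XY A B mA mB; apply: XY; apply: sub_sigma_algebra.
  by exists i => //; exists A => //; rewrite setTI.
by exists j => //; exists B => //; rewrite setTI.
Qed.

Lemma gaussian_process_measurable (I : Type) (X : I -> T -> R) (i : I) :
  gaussian_process P X -> measurable_fun setT (X i).
Proof.
move=> /(_ 1%N (fun=> i) (fun=> 1))[mX _].
by apply: eq_measurable_fun mX => w _; rewrite big_ord1 mul1r.
Qed.

Lemma Lfun2_sqr (X : T -> R) : measurable_fun setT X ->
  ('E_P[X ^+ 2] < +oo)%E -> X \in Lfun P 2%:E.
Proof.
move=> mX X2; rewrite inE; apply/andP; split; rewrite inE//=.
rewrite /finite_norm unlock/=; apply: poweR_lty.
apply: le_lt_trans X2; rewrite expectation.unlock.
rewrite le_eqVlt; apply/orP; left; apply/eqP.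
apply: eq_integral => w _; rewrite powR_mulrn// -normrX ger0_norm//.
exact: sqr_ge0.
Qed.

(** The covariance is an expectation with values in the extended reals, so a
    real value on the diagonal bounds the second moment. *)
Lemma centered_process_Lfun2 (I : Type) (X : I -> T -> R) K (i : I) :
  centered_gaussian_process P X K -> X i \in Lfun P 2%:E.
Proof.
move=> [gX EX CX]; apply: Lfun2_sqr.
  exact: gaussian_process_measurable gX.
have := CX i i; rewrite unlock EX/=.
have -> : (X i \- cst 0) * (X i \- cst 0) = X i ^+ 2.
  by apply/funext => w /=; rewrite !fctE/= subr0 expr2.
by move=> ->; rewrite ltry.
Qed.

End processes.

Lemma Q_cov_add_min (R : realType) (H : R) (s t : {nonneg R}) : 0 < H ->
  Q_cov (2 * H) s t + Num.min (s%:num `^ (2 * H)) (t%:num `^ (2 * H)) =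
  2 * fbm_cov H s t.
Proof.
move=> H0; rewrite /Q_cov /fbm_cov mulVKf//.
have H20 : 0 <= 2 * H by rewrite mulr_ge0// ltW.
have mono (x y : {nonneg R}) : x%:num <= y%:num ->
    x%:num `^ (2 * H) <= y%:num `^ (2 * H).
  by move=> xy; apply: ge0_ler_powR; rewrite ?nnegrE.
have [st|/ltW ts] := leP s%:num t%:num.
  by rewrite min_l ?mono// addrAC [in RHS](addrC (_ `^ _)).
by rewrite min_r ?mono// addrAC.
Qed.

(** The map [f] reindexes the second process; a deterministic time change
    preserves Gaussianity because the finite families of times it produces are
    among those of the original process. *)
Lemma add_independent_gaussian_process (R : realType) (d : measure_display)
    (T : measurableType d) (P : probability T R) (I J : Type)
    (X : I -> T -> R) (Y : J -> T -> R) (f : I -> J) (k : R)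
    (K : I -> I -> R) (L : J -> J -> R) :
  centered_gaussian_process P X K -> centered_gaussian_process P Y L ->
  independent_processes P X Y ->
  centered_gaussian_process P (fun t w => k * (X t w + Y (f t) w))
    (fun s t => k ^+ 2 * (K s t + L (f s) (f t))).
Proof.
move=> hX hY XY.
have X2 t := centered_process_Lfun2 t hX.
have Y2 t := centered_process_Lfun2 t hY.
have Pfin : P setT \is a fin_num by exact: fin_num_measure.
have X1 t := Lfun_subset12 Pfin (X2 t).
have Y1 t := Lfun_subset12 Pfin (Y2 t).
case: hX => gX EX CX; case: hY => gY EY CY.
have ZE t : (fun w => k * (X t w + Y (f t) w)) = k \o* (X t \+ Y (f t)).
  by apply/funext => w /=; rewrite mulrC.
have Z2 t : X t \+ Y (f t) \in Lfun P 2%:E by rewrite rpredD ?lee1n.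
have Z1 t := Lfun_subset12 Pfin (Z2 t).
split.
- move=> n t c.
  rewrite (_ : (fun _ => _) =
      (fun w => \sum_(i < n) (c i * k) * X (t i) w) \+
      (fun w => \sum_(i < n) (c i * k) * Y (f (t i)) w)); last first.
    apply/funext => w /=; rewrite -big_split/=; apply: eq_bigr => i _.
    by rewrite mulrA mulrDr.
  apply: gaussian_rv_add.
  + exact: independent_linear_combinations.
  + exact: gX.
  + exact: gY.
- by move=> t; rewrite ZE expectationZl// expectationD// EX EY adde0 mule0.
- move=> s t; rewrite !ZE covarianceZl//; last 2 first.
  + by rewrite Lfun_scale.
  + by apply: Lfun2_mul_Lfun1 => //; rewrite Lfun_scale ?ler1n.
  rewrite covarianceZr//; last exact: Lfun2_mul_Lfun1.
  rewrite covarianceDl// !covarianceDr// CX CY.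
  rewrite (independent_covariance0 (independent_coordinates _ _ XY))//.
  rewrite covarianceC.
  rewrite (independent_covariance0 (independent_coordinates _ _ XY))//.
  by rewrite adde0 add0e -!EFinD -!EFinM mulrA expr2.
Qed.

Theorem corollary1p2 (R : realType) (d : measure_display)
    (T : measurableType d) (P : probability T R) (H : R)
    (zeta beta : {nonneg R} -> T -> R) :
  0 < H -> H <= 2^-1 ->
  centered_gaussian_process P zeta (Q_cov (2 * H)) ->
  standard_brownian_motion P beta ->
  independent_processes P zeta beta ->
  fractional_brownian_motion P H
    (fun (t : {nonneg R}) (w : T) =>
       (Num.sqrt 2)^-1 * (zeta t w + beta (t%:num `^ (2 * H))%:nng w)).
Proof.
move=> H0 _ hzeta hbeta zb.
have [gZ EZ CZ] := add_independent_gaussian_process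
  (fun t : {nonneg R} => (t%:num `^ (2 * H))%:nng) (Num.sqrt 2)^-1
  hzeta hbeta zb.
split => // s t; rewrite CZ; congr EFin.
by rewrite Q_cov_add_min// exprVn sqr_sqrtr// mulKf.
Qed.
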